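(* For all integers $m\geq 3$ and $n\geq 1$, \[ \max\mathcal{R}(n; K_m, K_4) \leq n^{3/2}\sqrt{2m}. \]
   Context: An edge-colouring of a graph is an assignment of colours to its edges. A subgraph is monochromatic if all its edges receive the same colour, and rainbow if all its edge colours are pairwise distinct. For graphs $G,H$ and an integer $n$, $\max\mathcal{R}(n;G,H)$ denotes the maximum number of colours used in an edge-colouring of the complete graph $K_n$ such that $K_n$ contains no monochromatic subgraph isomorphic to $G$ and no rainbow subgraph isomorphic to $H$. Here $K_m$ and $K_4$ are complete graphs on $m$ and $4$ vertices. *)

(* Defs.v *)
From mathcomp Require Import all_boot.

Set Implicit Arguments.
Unset Strict Implicit.
Unset Printing Implicit Defensive.

Record sgraph := SGraph {
  vertex :> finType;
  adj : rel vertex;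
  adj_sym : symmetric adj;
  adj_irr : irreflexive adj }.

Definition edges (G : sgraph) : {set {set G}} :=
  [set e | [exists x : G, exists y : G, adj x y && (e == [set x; y])]].

Lemma neq_sym_rel (T : eqType) : symmetric (fun x y : T => x != y).
Proof. by move=> x y; rewrite eq_sym. Qed.

Lemma neq_irr_rel (T : eqType) : irreflexive (fun x y : T => x != y).
Proof. by move=> x; rewrite eqxx. Qed.

Definition complete (n : nat) : sgraph :=
  SGraph (@neq_sym_rel 'I_n) (@neq_irr_rel 'I_n).

(* [f] places a copy of [H] in [G] as a (not necessarily induced) subgraph;
   the edge set of that copy is [copy_edges f]. *)
Definition embedding (H G : sgraph) (f : {ffun H -> G}) : bool :=
  injectiveb f && [forall x, forall y, adj x y ==> adj (f x) (f y)].

Definition copy_edges (H G : sgraph) (f : {ffun H -> G}) : {set {set G}} :=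
  [set f @: (e : {set H}) | e in edges H].

(* An edge-colouring of [G] with colours in [C] is represented by a function
   [c : {set G} -> C], of which only the values on [edges G] are ever used. *)
Definition monochromatic (T : finType) (C : eqType) (c : T -> C) (F : {set T}) :
  bool := [forall e in F, forall e' in F, c e == c e'].

Definition rainbow (T : finType) (C : eqType) (c : T -> C) (F : {set T}) :
  bool := [forall e in F, forall e' in F, (e != e') ==> (c e != c e')].

Definition ncolours (T : finType) (C : eqType) (c : T -> C) (F : {set T}) :
  nat := size (undup [seq c e | e in F]).

Definition ramsey_admissible (n : nat) (G H : sgraph) (C : eqType)
    (c : {set complete n} -> C) : bool :=
  ~~ [exists f : {ffun G -> complete n},
        embedding f && monochromatic c (copy_edges f)] &&
  ~~ [exists f : {ffun H -> complete n},
        embedding f && rainbow c (copy_edges f)].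

(* The palette is the finite type [{set complete n}]: any colouring can be
   recoloured by naming each colour class after one of its edges, so this is
   no restriction (see [leq_maxR]). The value is 0 when no colouring is
   admissible; this does not occur for [G] = K_m with m >= 3 and [H] = K_4,
   since colouring each edge by its least endpoint is admissible. *)
Definition maxR (n : nat) (G H : sgraph) : nat :=
  \max_(c : {ffun {set complete n} -> {set complete n}}
        | ramsey_admissible G H c) ncolours c (edges (complete n)).

Lemma copy_edges_sub (H G : sgraph) (f : {ffun H -> G}) :
  embedding f -> copy_edges f \subset edges G.
Proof.
case/andP=> _ /forallP hf; apply/subsetP=> e /imsetP[d].
rewrite !inE => /existsP[x /existsP[y /andP[xy /eqP->]]] ->.
apply/existsP; exists (f x); apply/existsP; exists (f y).
by rewrite (implyP (forallP (hf x) y) xy) imsetU1 imset_set1 eqxx.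
Qed.

Section Recolouring.
Variables (n : nat) (G H : sgraph) (C : eqType) (c : {set complete n} -> C).

Let E := edges (complete n).

Let recol : {ffun {set complete n} -> {set complete n}} :=
  [ffun e => odflt e [pick e' in E | c e' == c e]].

Let c_recol e : e \in E -> c (recol e) = c e.
Proof.
move=> eE; rewrite ffunE; case: pickP => [d /andP[_ /eqP]//|/(_ e)].
by rewrite eE eqxx.
Qed.

Let recol_eq e e' : e \in E -> e' \in E ->
  (recol e == recol e') = (c e == c e').
Proof.
move=> eE e'E; apply/eqP/eqP => [ee'|ee'].
  by rewrite -(c_recol eE) ee' c_recol.
rewrite !ffunE ee'; case: pickP => // /(_ e').
by rewrite e'E eqxx.
Qed.

Let recol_admissible :
  ramsey_admissible G H recol = ramsey_admissible G H c.
Proof.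
congr (~~ _ && ~~ _); apply: eq_existsb => f.
  case: (boolP (embedding f)) => //= /copy_edges_sub/subsetP sub.
  apply: eq_forallb => e; case: (boolP (e \in _)) => //= /sub eE.
  apply: eq_forallb => e'; case: (boolP (e' \in _)) => //= /sub e'E.
  exact: recol_eq.
case: (boolP (embedding f)) => //= /copy_edges_sub/subsetP sub.
apply: eq_forallb => e; case: (boolP (e \in _)) => //= /sub eE.
apply: eq_forallb => e'; case: (boolP (e' \in _)) => //= /sub e'E.
by rewrite recol_eq.
Qed.

Let recol_ncolours : ncolours c E <= ncolours recol E.
Proof.
rewrite /ncolours -[leqRHS](size_map c); apply: uniq_leq_size.
  exact: undup_uniq.
move=> x; rewrite mem_undup => /imageP[e eE ->].
by rewrite -(c_recol eE); apply: map_f; rewrite mem_undup image_f.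
Qed.

Lemma leq_maxR :
  ramsey_admissible G H c -> ncolours c (edges (complete n)) <= maxR n G H.
Proof.
rewrite -recol_admissible => adm; apply: leq_trans recol_ncolours _.
by rewrite /maxR (bigD1 recol) //= leq_maxl.
Qed.

Lemma maxR_attained : ramsey_admissible G H c ->
  exists2 d : {ffun {set complete n} -> {set complete n}},
    ramsey_admissible G H d & ncolours d (edges (complete n)) = maxR n G H.
Proof.
rewrite -recol_admissible => adm.
pose A := [pred d : {ffun {set complete n} -> {set complete n}}
           | ramsey_admissible G H d].
have A0 : 0 < #|A| by apply/card_gt0P; exists recol.
have [d dA] := eq_bigmax_cond
  (fun d : {ffun {set complete n} -> {set complete n}} => ncolours d E) A0.
by exists d.
Qed.

End Recolouring.

(* Main.v *)
(* Call a colour private to [u] in a vertex set [A] if deleting [u] from [A]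
   destroys it. Suppose every vertex has at least [r] private colours, and
   choose for each one a neighbour through an edge of that colour. If [u] and
   [v] share the chosen neighbours [x] and [y], then none of the colours of
   [ux], [uy], [vx], [vy] can be that of [xy], so the absence of a rainbow K_4
   forces [xy] to have the colour of [uv], after discarding at most one shared
   neighbour. As there is no monochromatic K_m, two vertices share at most [m]
   chosen neighbours, and double counting gives [r(r-1) <= m(n-1)], hence
   [r^2 <= 2mn]. Thus some vertex always has at most [sqrt(2mn)] private
   colours; deleting such vertices one by one bounds the number of colours by
   [n * sqrt(2mn)]. *)

Require Import Defs.
From mathcomp Require Import all_boot all_order all_algebra.
From mathcomp Require Import reals exp.
From mathcomp Require Import zify ring.

Set Implicit Arguments.
Unset Strict Implicit.
Unset Printing Implicit Defensive.

Import Order.TTheory GRing.Theory Num.Theory.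

(** Double counting: the squares of the in-degrees [d w] sum to the sizes of all [N u :&: N v], and
    are bounded below through [(d w - r)^2 >= 0]. *)
Lemma card_codegree (T : finType) (A : {set T}) (N : T -> {set T}) (r m : nat) :
    (forall u, u \in A -> N u \subset A) -> (forall u, u \in A -> r <= #|N u|) ->
    {in A &, forall u v, u != v -> #|N u :&: N v| <= m} ->
  #|A| * (r * r.-1) <= #|A| * (#|A|.-1 * m).
Proof.
move=> NA rN Nm; pose d w := \sum_(u in A) (w \in N u).
have cardN (B : {set T}) : B \subset A -> #|B| = \sum_(w in A) (w \in B).
  move=> /setIidPr BA; rewrite -{1}BA -sum1_card.
  under eq_bigl do rewrite inE.
  by rewrite big_mkcondr; apply: eq_bigr => w _; case: ifP.
have sum_d : \sum_(w in A) d w = \sum_(u in A) #|N u|.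
  rewrite exchange_big; apply: eq_bigr => u uA; rewrite cardN ?NA //.
have sum_d2 : \sum_(w in A) d w * d w = \sum_(u in A) \sum_(v in A) #|N u :&: N v|.
  under eq_bigr do rewrite big_distrlr /=.
  rewrite exchange_big; apply: eq_bigr => u uA.
  rewrite exchange_big; apply: eq_bigr => v vA.
  rewrite cardN; last by rewrite subIset ?NA.
  by apply: eq_bigr => w _; rewrite inE mulnb.
have upper : \sum_(w in A) d w * d w <=
    \sum_(u in A) #|N u| + #|A| * (#|A|.-1 * m).
  rewrite sum_d2 -[X in _ + X]sum_nat_const -big_split leq_sum // => u uA.
  rewrite (bigD1 u) //= setIid leq_add2l.
  rewrite (eq_bigl (mem (A :\ u))); last by move=> v; rewrite !inE andbC.
  rewrite (cardsD1 u A) uA /= -sum_nat_const leq_sum // => v /setD1P[vu vA].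
  by rewrite Nm // eq_sym.
have lower : 2 * r * \sum_(w in A) d w <= \sum_(w in A) d w * d w + #|A| * (r * r).
  rewrite -sum_nat_const -big_split big_distrr leq_sum //= => w _.
  by have := (nat_Cauchy r (d w)).1; rewrite !mulnn mulnA addnC.
have Dr : #|A| * r <= \sum_(u in A) #|N u| by rewrite -sum_nat_const leq_sum.
rewrite {}sum_d in lower.
(* With [D] the sum of the [#|N u|], the bounds give [(2r-1)D <= #|A|(#|A|-1)m + #|A|r^2]; for
   [r > 0] the factor [2r-1] is positive and [D >= #|A|r] applies. *)
case: r => [|r] in rN lower Dr *; first by rewrite mul0n muln0.
nia.
Qed.

(** * Private colours and shared representatives *)

Section PrivateColours.
Variables (T C : finType) (c : {set T} -> C).

Definition colours (A : {set T}) : {set C} :=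
  c @: [set e : {set T} | (e \subset A) && (#|e| == 2)].

Definition private (A : {set T}) (u : T) : {set C} :=
  colours A :\: colours (A :\ u).

Lemma colours_edge (A : {set T}) x y :
  x \in A -> y \in A -> x != y -> c [set x; y] \in colours A.
Proof.
move=> xA yA xy; apply: imset_f; rewrite inE cards2 xy eqxx andbT.
by apply/subsetP=> z /set2P[] ->.
Qed.

(** An edge of [A] avoiding [u] survives in [A :\ u], so its colour is not private to [u]. *)
Lemma private_edge A u z :
  z \in private A u -> exists2 w, w \in A :\ u & c [set u; w] = z.
Proof.
case/setDP=> /imsetP[e]; rewrite inE => /andP[/subsetP eA].
case/cards2P=> x [y [xy eE]] ->; subst e => new.
have [xA yA] : x \in A /\ y \in A by rewrite !eA ?set21 ?set22.
have [xu|xu] := eqVneq x u; first by subst x; exists y; rewrite // !inE eq_sym xy.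
have [yu|yu] := eqVneq y u; first by subst y; exists x; rewrite ?inE ?xy // setUC.
by case/negP: new; apply: colours_edge; rewrite ?inE ?xu ?yu.
Qed.

Lemma private_notin (A : {set T}) u x y : x \in A :\ u -> y \in A :\ u -> x != y ->
  c [set x; y] \notin private A u.
Proof. by move=> xA yA xy; rewrite inE colours_edge. Qed.

(** By [private_edge] the search always succeeds, so the default [u] never enters. *)
Definition reps (A : {set T}) (u : T) : {set T} :=
  [set odflt u [pick w in A :\ u | c [set u; w] == z] | z in private A u].

Lemma reps_edge A u : {in private A u, forall z,
  let w := odflt u [pick w in A :\ u | c [set u; w] == z] in
  w \in A :\ u /\ c [set u; w] = z}.
Proof.
move=> z /private_edge[w wA wz]; case: pickP => [x /andP[xA /eqP]//|/(_ w)].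
by rewrite wA wz eqxx.
Qed.

Lemma repsP A u w : w \in reps A u ->
  [/\ w != u, w \in A & c [set u; w] \in private A u].
Proof.
case/imsetP=> z zP ->; have [/setD1P[? ?] cz] := reps_edge zP.
by rewrite cz.
Qed.

Lemma card_reps A u : #|reps A u| = #|private A u|.
Proof.
apply: card_in_imset => x y /reps_edge[_ xE] /reps_edge[_ yE] xy.
by rewrite -xE -yE xy.
Qed.

Lemma reps_inj A u : {in reps A u &, injective (fun w => c [set u; w])}.
Proof.
move=> _ _ /imsetP[x xP ->] /imsetP[y yP ->].
by have [_ ->] := reps_edge xP; have [_ ->] := reps_edge yP => ->.
Qed.

Variable m : nat.
Hypothesis no_rainbow : forall a b x y, uniq [:: a; b; x; y] ->
  ~~ uniq [:: c [set a; b]; c [set a; x]; c [set a; y];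
              c [set b; x]; c [set b; y]; c [set x; y]].
Hypothesis no_mono : forall (W : {set T}) z,
  {in W &, forall x y, x != y -> c [set x; y] = z} -> #|W| < m.

Lemma card_common_reps (A : {set T}) u v : u \in A -> v \in A -> u != v ->
  #|reps A u :&: reps A v| <= m.
Proof.
move=> uA vA uv; set W := _ :&: _.
(* Both ends of the edge [aw] lie in [A :\ b], so it survives the deletion of [b]. *)
have offdiag a b w : a \in A -> a != b -> w \in reps A a -> w \in reps A b ->
  c [set a; w] \notin private A b.
  move=> aA ab /repsP[wa wA _] /repsP[wb _ _].
  by rewrite private_notin ?inE ?ab ?wb // eq_sym.
(* The colour of [uv] may be shared with [uw] or [vw] for one [w] only. *)
pose bad := [set w in W | c [set u; v] \in [set c [set u; w]; c [set v; w]]].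
have bad1 : #|bad| <= 1.
  (* Two vertices of [bad] matched through the same end coincide by [reps_inj]; through different
     ends, a colour private to [v] would equal that of an edge surviving the deletion of [v]. *)
  apply/card_le1_eqP => x y; rewrite !inE.
  case/andP=> /andP[xu xv] /orP[]/eqP ex /andP[/andP[yu yv] /orP[]/eqP ey].
  - by apply: (@reps_inj A u) => //; rewrite -ex -ey.
  - by have [_ _] := repsP yv; rewrite -ey ex (negPf (offdiag _ _ _ uA uv xu xv)).
  - by have [_ _] := repsP xv; rewrite -ex ey (negPf (offdiag _ _ _ uA uv yu yv)).
  - by apply: (@reps_inj A v) => //; rewrite -ex -ey.
have good w : w \in W :\: bad -> [/\ w \in reps A u, w \in reps A v,
    c [set u; v] != c [set u; w] & c [set u; v] != c [set v; w]].
  rewrite !inE negb_and => /andP[+ /andP[wu wv]].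
  by rewrite wu wv /= negb_or => /andP[].
(* Such a clique has at most [m - 1] vertices and [bad] at most one, so [W] has at most [m]. *)
suff /no_mono : {in W :\: bad &, forall x y, x != y -> c [set x; y] = c [set u; v]}.
  have := cardsID bad W; have : #|W :&: bad| <= #|bad| by rewrite subset_leq_card ?subsetIr.
  lia.
move=> x y /good[xu xv uvux uvvx] /good[yu yv uvuy uvvy] xy.
have [xnu xA pux] := repsP xu; have [ynu yA puy] := repsP yu.
have [xnv _ pvx] := repsP xv; have [ynv _ pvy] := repsP yv.
have diff z (P : {set C}) z' : z' \in P -> z \notin P -> (z == z') = false.
  by move=> z'P; apply: contraNF => /eqP->.
have xyNu : c [set x; y] \notin private A u by rewrite private_notin ?inE ?xnu ?ynu.
have xyNv : c [set x; y] \notin private A v by rewrite private_notin ?inE ?xnv ?ynv.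
have uxuy : c [set u; x] == c [set u; y] = false.
  by apply: contraNF xy => /eqP/(reps_inj xu yu)->.
have vxvy : c [set v; x] == c [set v; y] = false.
  by apply: contraNF xy => /eqP/(reps_inj xv yv)->.
(* Of the fifteen pairs among the six colours on [u], [v], [x], [y], fourteen are distinct; only
   [uv] against [xy] is left to break the rainbow. *)
have := @no_rainbow u v x y.
rewrite /= !inE !negb_or uv xy ![u == _]eq_sym ![v == _]eq_sym xnu ynu xnv ynv.
rewrite uvux uvuy uvvx uvvy uxuy vxvy.
rewrite !(diff _ _ _ pvx, diff _ _ _ pvy) ?(offdiag u v) //.
rewrite ![_ == c [set x; y]]eq_sym !(diff _ _ _ pux, diff _ _ _ puy) //.
rewrite !(diff _ _ _ pvx, diff _ _ _ pvy) //= andbT.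
by move=> /(_ isT); rewrite negbK => /eqP.
Qed.

Lemma few_private (A : {set T}) s : 0 < m -> 0 < #|A| ->
  2 * m * #|A| < s.+1 ^ 2 -> exists2 u, u \in A & #|private A u| <= s.
Proof.
move=> m0 A0 sA; apply/exists_inP; apply: contraLR sA.
rewrite negb_exists_in -leqNgt => /forall_inP many.
have := @card_codegree T A (reps A) s.+1 m.
rewrite leq_pmul2l //= => /(_ _ _ _)/wrap[].
- by move=> u _; apply/subsetP => w /repsP[].
- by move=> u uA; rewrite card_reps ltnNge many.
- by move=> u v; apply: card_common_reps.
(* For [s > 0], [(s+1)^2 <= 2s(s+1)]; for [s = 0] the goal is [1 <= 2m#|A|]. *)
- nia.
Qed.

(** Induction on [#|A|] with [s] fixed: the bound on [2 * m * #|A|] passes to smaller sets, and each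
    deleted vertex costs at most [s] colours. *)
Lemma card_colours (A : {set T}) s : 0 < m ->
  2 * m * #|A| < s.+1 ^ 2 -> #|colours A| <= #|A| * s.
Proof.
move=> m0; have [k] := ubnP #|A|; elim: k A => // k IH A /ltnSE Ak sA.
have [A0|A0] := posnP #|A|.
  rewrite A0 leqn0 cards_eq0; apply/set0Pn => -[_ /imsetP[e + _]].
  by rewrite inE (cards0_eq A0) subset0 => /andP[/eqP->]; rewrite cards0.
have [u uA us] := few_private m0 A0 sA.
have Au := cardsD1 u A; rewrite uA in Au.
have : #|colours (A :\ u)| <= #|A :\ u| * s by apply: IH; nia.
have : #|colours A :&: colours (A :\ u)| <= #|colours (A :\ u)|.
  by rewrite subset_leq_card ?subsetIr.
rewrite -(cardsID (colours (A :\ u)) (colours A)) -/(private A u) Au; nia.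
Qed.

End PrivateColours.

(** * From embeddings of complete graphs to sets of vertices *)

Lemma edges_complete n (e : {set complete n}) : (e \in edges (complete n)) = (#|e| == 2).
Proof.
rewrite inE; apply/existsP/cards2P => [[x /existsP[y /andP[xy /eqP->]]]|[x [y [xy ->]]]].
  by exists x, y.
by exists x; apply/existsP; exists y; rewrite /= xy /=.
Qed.

Lemma copy_edgesP k n (f : {ffun complete k -> complete n}) e :
  e \in copy_edges f -> exists x y, x != y /\ e = [set f x; f y].
Proof.
case/imsetP=> d; rewrite edges_complete => /cards2P[x [y [xy ->]]] ->.
by exists x, y; rewrite imsetU1 imset_set1.
Qed.

Lemma embedding_complete k n (f : {ffun complete k -> complete n}) :
  injective f -> embedding f.
Proof.
move=> fI; apply/andP; split; first exact/injectiveP.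
by do 2!apply/forallP=> ?; apply/implyP; apply: contra => /eqP/fI->.
Qed.

Lemma ncolours_complete n (C : finType) (c : {set complete n} -> C) :
  ncolours c (edges (complete n)) = #|colours c [set: complete n]|.
Proof.
rewrite /ncolours -(card_uniqP (undup_uniq _)); apply: eq_card => z.
rewrite mem_undup; apply/imageP/imsetP => -[e eE ->]; exists e => //.
  by move: eE; rewrite edges_complete inE subsetT.
by move: eE; rewrite edges_complete inE => /andP[].
Qed.

Section Admissible.
Variables (n m : nat) (C : finType) (c : {set complete n} -> C).
Hypothesis adm : ramsey_admissible (complete m) (complete 4) c.

Lemma admissible_rainbow (a b x y : complete n) : uniq [:: a; b; x; y] ->
  ~~ uniq [:: c [set a; b]; c [set a; x]; c [set a; y];
              c [set b; x]; c [set b; y]; c [set x; y]].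
Proof.
move=> abxy; apply/negP=> cU; case/andP: adm => _ /existsP; apply.
pose f := [ffun i : complete 4 => nth a [:: a; b; x; y] (i : 'I_4)].
exists f; apply/andP; split.
  apply: embedding_complete => i j; rewrite !ffunE => /eqP.
  by rewrite nth_uniq // => /eqP/val_inj.
pose L := [:: [set a; b]; [set a; x]; [set a; y]; [set b; x]; [set b; y]; [set x; y]].
have fL e : e \in copy_edges f -> e \in L.
  case/copy_edgesP=> i [j [ij ->]]; rewrite !ffunE.
  by case: i j ij => [[|[|[|[|]]]] // ?] [[|[|[|[|]]]] // ?] //= _;
    rewrite !inE ?eqxx ?orbT // setUC eqxx ?orbT.
apply/forallP => e; apply/implyP => /fL eL.
apply/forallP => e'; apply/implyP => /fL e'L; apply/implyP.
apply: contra => /eqP cee'.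
(* Injectivity of [c] on [L] is read off positions: equal colours sit at the same index of
   [map c L]. *)
have cU' : uniq (map c L) by [].
rewrite -(nth_index set0 eL) -(nth_index set0 e'L) nth_uniq ?index_mem ?(map_uniq cU') //.
rewrite -(nth_uniq (c set0) _ _ cU') ?size_map ?index_mem //.
by rewrite !(nth_map set0) ?index_mem // !nth_index // cee'.
Qed.

Lemma admissible_mono (W : {set complete n}) z :
  {in W &, forall x y, x != y -> c [set x; y] = z} -> #|W| < m.
Proof.
move=> Wz; rewrite ltnNge; apply/negP=> mW.
case/andP: adm => /existsP + _; apply.
pose g (i : 'I_m) : complete n := enum_val (widen_ord mW i).
have gI : injective g by move=> i j /enum_val_inj[ij]; apply: val_inj.
exists [ffun i : complete m => g i]; apply/andP; split.
  by apply: embedding_complete => i j; rewrite !ffunE => /gI.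
have cz e : e \in copy_edges [ffun i : complete m => g i] -> c e = z.
  case/copy_edgesP=> i [j [ij ->]]; rewrite !ffunE Wz ?enum_valP //.
  by apply: contra ij => /eqP/gI->.
by do 2![apply/forallP => ?; apply/implyP => /cz->].
Qed.

End Admissible.

Lemma maxR_leq n m s : 0 < m -> 2 * m * n < s.+1 ^ 2 ->
  maxR n (complete m) (complete 4) <= n * s.
Proof.
move=> m0 ns; apply/bigmax_leqP => c adm; rewrite ncolours_complete.
have := @card_colours _ _ c m (admissible_rainbow adm) (admissible_mono adm)
  [set: complete n] s m0.
by rewrite cardsT card_ord; apply.
Qed.

Local Open Scope ring_scope.

Theorem theorem1 (R : realType) (m n : nat) (hm : (3 <= m)%N) (hn : (1 <= n)%N) :
  (maxR n (complete m) (complete 4))%:R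
    <= (n%:R : R) `^ (3%:R / 2%:R) * Num.sqrt ((2 * m)%N%:R).
Proof.
(* [s] is the integer square root of [2mn]: [slt] feeds [maxR_leq], and [sle] gives
   [s <= sqrt(2mn)]. *)
have [s sle slt] : exists2 s, (s ^ 2 <= 2 * m * n)%N & (2 * m * n < s.+1 ^ 2)%N.
  have ex0 : exists s, (s ^ 2 <= 2 * m * n)%N by exists 0.
  have bd s : (s ^ 2 <= 2 * m * n -> s <= 2 * m * n)%N by nia.
  case: (ex_maxnP ex0 bd) => s sle smax; exists s => //.
  by rewrite ltnNge; apply/negP => /smax; rewrite ltnn.
have n0 : (n%:R : R) != 0 by rewrite pnatr_eq0 -lt0n.
(* Splitting the exponent turns the right-hand side into [n * sqrt(n * 2m)]. *)
have -> : 3%:R / 2%:R = 1 + 2^-1 :> R by field.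
rewrite powRD ?n0 ?implybT // powRr1 // powR12_sqrt // -mulrA -sqrtrM //.
have := maxR_leq (ltn_trans (ltn0Sn 1) hm) slt.
rewrite -(ler_nat R) natrM => /le_trans; apply; rewrite ler_wpM2l //.
rewrite -[leLHS]ger0_norm // -sqrtr_sqr ler_wsqrtr // -natrX -natrM ler_nat.
by rewrite mulnC.
Qed.
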